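(* Let $\Gamma$ be a groupoid, $D$ a $\Gamma$-graded division ring and $M$ a $\Gamma$-graded right $D$-module. The following assertions hold: (1) $M$ is pseudo-free. (2) Any pseudo-linearly independent sequence of $M$ can be extended to a pseudo-basis of $M$. (3) Any two pseudo-bases of $M$ have the same cardinality.
   Context: A groupoid $\Gamma$ is a small category with all morphisms invertible, identified with its set of morphisms; $\Gamma_0$ is its set of objects (identified with identity morphisms). For $\gamma:e\to f$ write $d(\gamma)=e$, $r(\gamma)=f$; $\delta\gamma$ is defined iff $d(\delta)=r(\gamma)$. A $\Gamma$-graded ring is an associative ring $R=\bigoplus_{\gamma\in\Gamma}R_\gamma$ (additive subgroups) with $R_\gamma R_\delta\subseteq R_{\gamma\delta}$ if $\gamma\delta$ is defined and $R_\gamma R_\delta=0$ otherwise, assumed object unital: for each $e\in\Gamma_0$, $R_e$ is a unital ring with identity $1_e$ (possibly $1_e=0$) and $1_{r(\gamma)}a=a=a1_{d(\gamma)}$ for $a\in R_\gamma$. A $\Gamma$-graded right $R$-module is a right $R$-module $M=\bigoplus_\gamma M_\gamma$ with $M_\gamma R_\delta\subseteq M_{\gamma\delta}$ (zero if $\gamma\delta$ is undefined), assumed unital: $MR=M$. A homogeneous element of degree $\gamma$ is a nonzero element of $M_\gamma$. A $\Gamma$-graded division ring is a $\Gamma$-graded ring $D\neq0$ such that each nonzero $a\in D_\gamma$ has an element $a^{-1}\in D_{\gamma^{-1}}$ with $aa^{-1}=1_{r(\gamma)}$ and $a^{-1}a=1_{d(\gamma)}$. A sequence $(x_i)_{i\in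 I}$ of homogeneous elements, $x_i\in M_{\gamma_i}$, is pseudo-linearly independent if the only $(a_i)_{i\in I}\in\bigoplus_{i\in I}1_{d(\gamma_i)}D$ with $\sum_{i}x_ia_i=0$ is $(a_i)=0$. It is a pseudo-basis of $M$ if it is pseudo-linearly independent and generates $M$ as a $D$-module. $M$ is pseudo-free if it has a pseudo-basis. *)

(* Defs.v *)
From mathcomp Require Import all_boot all_order all_algebra.
From mathcomp Require Import all_classical.

Set Implicit Arguments.
Unset Strict Implicit.
Unset Printing Implicit Defensive.

Import GRing.Theory.

Local Open Scope classical_set_scope.
Local Open Scope ring_scope.

(* A small category with all morphisms invertible. [gmul g h] is the composite
   "g after h"; it is total, but constrained only when [dom g = cod h]. *)
Record groupoid := Groupoid {
  gobj : Type;
  gmor :> choiceType;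
  dom : gmor -> gobj;
  cod : gmor -> gobj;
  gid : gobj -> gmor;
  gmul : gmor -> gmor -> gmor;
  ginv : gmor -> gmor;
  dom_id : forall e, dom (gid e) = e;
  cod_id : forall e, cod (gid e) = e;
  dom_mul : forall g h, dom g = cod h -> dom (gmul g h) = dom h;
  cod_mul : forall g h, dom g = cod h -> cod (gmul g h) = cod g;
  gmulA : forall g h k, dom g = cod h -> dom h = cod k ->
    gmul g (gmul h k) = gmul (gmul g h) k;
  gmul_idl : forall g, gmul (gid (cod g)) g = g;
  gmul_idr : forall g, gmul g (gid (dom g)) = g;
  dom_inv : forall g, dom (ginv g) = cod g;
  cod_inv : forall g, cod (ginv g) = dom g;
  gmulVg : forall g, gmul (ginv g) g = gid (dom g);
  gmulgV : forall g, gmul g (ginv g) = gid (cod g)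
}.

(* [f] is an element of the external direct sum of the [A i]. *)
Definition in_direct_sum (I : choiceType) (V : zmodType) (A : I -> set V)
    (f : I -> V) : Prop :=
  (forall i, A i (f i)) /\ finite_set [set i | f i != 0].

(* [V] is the internal direct sum of the additive subgroups [A i]. *)
Definition is_direct_sum (I : choiceType) (V : zmodType) (A : I -> set V) :
    Prop :=
  (forall i, zmod_closed [in A i]) /\
  (forall v, exists! f : I -> V,
     in_direct_sum A f /\ v = \sum_(i \in [set: I]) f i).

(* The ring itself is not assumed to have an identity; only object unitality
   is required. *)
Record graded_ring (G : groupoid) := GradedRing {
  gr_sort :> zmodType;
  rmul : gr_sort -> gr_sort -> gr_sort;
  rmulA : associative rmul;
  rmulDl : forall a b c, rmul (a + b) c = rmul a c + rmul b c;
  rmulDr : forall a b c, rmul a (b + c) = rmul a b + rmul a c;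
  rcomp : G -> set gr_sort;
  rcomp_sum : is_direct_sum rcomp;
  rcomp_mul : forall (g h : G) a b, rcomp g a -> rcomp h b ->
    dom g = cod h -> rcomp (gmul g h) (rmul a b);
  rcomp_mul0 : forall (g h : G) a b, rcomp g a -> rcomp h b ->
    dom g <> cod h -> rmul a b = 0;
  robj1 : gobj G -> gr_sort;
  robj1_comp : forall e, rcomp (gid e) (robj1 e);
  robj1_mull : forall (g : G) a, rcomp g a -> rmul (robj1 (cod g)) a = a;
  robj1_mulr : forall (g : G) a, rcomp g a -> rmul a (robj1 (dom g)) = a
}.

Definition graded_division_ring (G : groupoid) (D : graded_ring G) : Prop :=
  (exists a : D, a <> 0) /\
  forall (g : G) (a : D), rcomp g a -> a <> 0 ->
    exists b : D, [/\ rcomp (ginv g) b,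
      rmul a b = robj1 D (cod g) & rmul b a = robj1 D (dom g)].

(* Right modules; [mact_unital] is the condition MR = M, where MR is the set of
   finite sums of elements m r. *)
Record graded_module (G : groupoid) (R : graded_ring G) := GradedModule {
  gm_sort :> zmodType;
  mact : gm_sort -> R -> gm_sort;
  mactA : forall m a b, mact (mact m a) b = mact m (rmul a b);
  mactDl : forall m n a, mact (m + n) a = mact m a + mact n a;
  mactDr : forall m a b, mact m (a + b) = mact m a + mact m b;
  mact_unital : forall m, exists (n : nat) (u : 'I_n -> gm_sort)
    (a : 'I_n -> R), m = \sum_(j < n) mact (u j) (a j);
  mcomp : G -> set gm_sort;
  mcomp_sum : is_direct_sum mcomp;
  mcomp_act : forall (g h : G) m a, mcomp g m -> rcomp h a ->
    dom g = cod h -> mcomp (gmul g h) (mact m a);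
  mcomp_act0 : forall (g h : G) m a, mcomp g m -> rcomp h a ->
    dom g <> cod h -> mact m a = 0
}.

Section PseudoBases.
Variables (G : groupoid) (D : graded_ring G) (M : graded_module D).

Definition homogeneous (g : G) (m : M) : Prop := mcomp g m /\ m <> 0.

(* The right ideal 1_e D. *)
Definition obj_ideal (e : gobj G) : set D := range (rmul (robj1 D e)).

Definition submodule (N : set M) : Prop :=
  zmod_closed [in N] /\ forall m a, N m -> N (mact m a).

Definition generates (I : Type) (x : I -> M) : Prop :=
  forall N : set M, submodule N -> (forall i, N (x i)) -> N = setT.

(* The degrees [g i] are determined by the nonzero elements [x i]. *)
Definition pseudo_independent (I : choiceType) (x : I -> M) : Prop :=
  exists g : I -> G,
    (forall i, homogeneous (g i) (x i)) /\
    forall a : I -> D, in_direct_sum (fun i => obj_ideal (dom (g i))) a ->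
      \sum_(i \in [set: I]) mact (x i) (a i) = 0 -> forall i, a i = 0.

Definition pseudo_basis (I : choiceType) (x : I -> M) : Prop :=
  pseudo_independent x /\ generates x.

Definition pseudo_free : Prop :=
  exists (I : choiceType) (x : I -> M), pseudo_basis x.

End PseudoBases.

(* Main.v *)
Require Import Defs.
From mathcomp Require Import all_boot all_order all_algebra finmap.
From mathcomp Require Import all_classical.

Set Implicit Arguments.
Unset Strict Implicit.
Unset Printing Implicit Defensive.

Import GRing.Theory.

Local Open Scope classical_set_scope.
Local Open Scope ring_scope.

(** Pseudo-linear independence is governed by a closure operator, as in the
theory of matroids.  For a set S of homogeneous elements of M, let span S be
the submodule it generates, and call S independent if no element of S lies in
the span of the others.  Three facts are used.

- The span of homogeneous elements is a graded submodule: it contains the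
  homogeneous components of its elements ([span_graded]).  Since nonzero
  homogeneous scalars are invertible, a homogeneous element outside such a span
  is cancellable modulo it ([graded_cancel]), and adjoining it to an
  independent set gives an independent set ([indep_setU1]).
- The span has finite character, so the union of a chain of independent sets
  is independent ([indep_bigcup]).
- A family is pseudo-linearly independent exactly when it is injective with
  independent range ([pseudo_independent_indep],
  [indep_pseudo_independent]).  Hence the statements on families become
  statements on sets.

By Zorn's lemma an independent set extends to a maximal one, which spans M
because M is generated by its homogeneous elements ([exists_maximal_indep]).
This is the extension property, and the existence of a pseudo-basis is the case
of the empty family.

As for cardinalities, an independent set A injects into any homogeneous
spanning set B ([indep_card_le]), and the theorem of Cantor and Bernstein concludes.  The
injection comes from a second use of Zorn's lemma, on the partial injections of
A into B for which replacing the elements of the domain by their images keeps A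
independent.  If such an injection misses an element a of A, the modified set
without a does not span a, hence does not span some element b of B, and sending
a to b extends the injection.  This argument treats finite and infinite
bases alike. *)

(** * Additive subgroups and finitely supported sums *)

Lemma zmod_closed_setP (V : zmodType) (N : set V) :
  zmod_closed [in N] <-> N 0 /\ (forall u v, N u -> N v -> N (u - v)).
Proof.
split=> [[N0 NB]|[N0 NB]].
  split=> [|u v Nu Nv]; first by have := N0; rewrite inE.
  have := NB u v; rewrite !inE; exact.
by split=> [|u v]; rewrite !inE; [exact: N0|exact: NB].
Qed.

Section FiniteSums.
Variables (I : choiceType) (V W : zmodType).

Lemma finite_support_fset (f : I -> V) : finite_set [set i | f i != 0] ->
  exists A : {fset I}, forall i, i \notin A -> f i = 0.
Proof.
move=> /finite_fsetP[A fA]; exists A => i; apply: contraNeq => fi.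
by have : [set j | f j != 0] i by []; rewrite fA.
Qed.

Lemma finite_supportB (f g : I -> V) :
  finite_set [set i | f i != 0] -> finite_set [set i | g i != 0] ->
  finite_set [set i | f i - g i != 0].
Proof.
move=> ff fg; apply: (@sub_finite_set _ _
  ([set i | f i != 0] `|` [set i | g i != 0])); last by rewrite finite_setU.
move=> i /= fgi; case: (eqVneq (f i) 0) => [fi|]; last by left.
by right; apply: contraNneq fgi => gi; rewrite fi gi subr0.
Qed.

Lemma fsumrB (f g : I -> V) :
  finite_set [set i | f i != 0] -> finite_set [set i | g i != 0] ->
  \sum_(i \in [set: I]) (f i - g i) =
  \sum_(i \in [set: I]) f i - \sum_(i \in [set: I]) g i.
Proof.
move=> /finite_support_fset[A fA] /finite_support_fset[B gB].
have f0 i : i \notin (A `|` B)%fset -> f i = 0.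
  by rewrite in_fsetU negb_or => /andP[/fA].
have g0 i : i \notin (A `|` B)%fset -> g i = 0.
  by rewrite in_fsetU negb_or => /andP[_ /gB].
rewrite !(@fsbigTE _ _ _ _ (A `|` B)%fset) ?sumrB// => i iAB.
by rewrite f0// g0// subr0.
Qed.

Lemma fsumr_morph (phi : V -> W) (f : I -> V) :
  phi 0 = 0 -> {morph phi : u v / u + v} -> finite_set [set i | f i != 0] ->
  phi (\sum_(i \in [set: I]) f i) = \sum_(i \in [set: I]) phi (f i).
Proof.
move=> phi0 phiD /finite_support_fset[A fA].
rewrite (@fsbigTE _ _ _ _ A)// (@fsbigTE _ _ _ _ A) => [|i /fA->//].
exact: big_morph.
Qed.

Lemma finite_support1 (j : I) (v : V) :
  finite_set [set i | (if i == j then v else 0) != 0].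
Proof.
apply: (@sub_finite_set _ _ [set j]) => // i /=.
by case: (eqVneq i j) => //; rewrite eqxx.
Qed.

Lemma fsumr1 (j : I) (v : V) :
  \sum_(i \in [set: I]) (if i == j then v else 0) = v.
Proof.
rewrite (@fsbigTE _ _ _ _ [fset j]%fset) => [|i].
  by rewrite big_seq_fset1 eqxx.
by rewrite inE => /negPf->.
Qed.

End FiniteSums.

(** * Components in an internal direct sum *)

Section Components.
Variables (I : choiceType) (V : zmodType) (A : I -> set V).
Hypothesis hA : is_direct_sum A.

Definition component (i : I) (v : V) : V := sval (cid (hA.2 v)) i.

Lemma summand0 i : A i 0.
Proof. by have /zmod_closed_setP[] := hA.1 i. Qed.

Lemma summandB i u v : A i u -> A i v -> A i (u - v).
Proof. by have /zmod_closed_setP[_] := hA.1 i; apply. Qed.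

Lemma component_spec v : in_direct_sum A (component^~ v) /\
  v = \sum_(i \in [set: I]) component i v.
Proof. by have [] := svalP (cid (hA.2 v)). Qed.

Lemma component_in i v : A i (component i v).
Proof. by have [[]] := component_spec v. Qed.

Lemma component_uniq (f : I -> V) i v :
  in_direct_sum A f -> v = \sum_(j \in [set: I]) f j -> component i v = f i.
Proof.
move=> fA vf; have [_ uniq] := svalP (cid (hA.2 v)).
by rewrite -(uniq f).
Qed.

Lemma component_hom i j v : A j v -> component i v = if i == j then v else 0.
Proof.
move=> Av; apply: (component_uniq (f := fun i => if i == j then v else 0)).
  split; last exact: finite_support1.
  by move=> k; case: eqP => [->//|_]; exact: summand0.
by rewrite fsumr1.
Qed.

Lemma component_id i v : A i v -> component i v = v.
Proof. by move=> Av; rewrite (component_hom _ Av) eqxx. Qed.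

Lemma component0 i : component i 0 = 0.
Proof. exact: component_id (summand0 i). Qed.

Lemma componentB i u v : component i (u - v) = component i u - component i v.
Proof.
have [[Au fu] Su] := component_spec u; have [[Av fv] Sv] := component_spec v.
apply: (component_uniq (f := fun i => component i u - component i v)).
  by split=> [j|]; [exact: summandB|exact: finite_supportB].
by rewrite fsumrB// -Su -Sv.
Qed.

Lemma componentD i : {morph component i : u v / u + v}.
Proof.
move=> u v; rewrite -[in LHS](opprK v) componentB -(sub0r v) componentB.
by rewrite component0 sub0r opprK.
Qed.

(** Additive statements may be checked on the components of a vector; most
computations with degrees below are done in this way, so that no explicit sum
of components has to be expanded. *)
Lemma component_ind (P : V -> Prop) v :
  P 0 -> (forall u w, P u -> P w -> P (u + w)) ->
  (forall i, P (component i v)) -> P v.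
Proof.
move=> P0 PD Pv; have [[_ fv] ->] := component_spec v.
have [B vB] := finite_support_fset fv.
by rewrite (@fsbigTE _ _ _ _ B)//; apply: big_ind.
Qed.

End Components.

Arguments component_ind [I V A] hA P v.

(** * Homogeneous components of products *)

Section GradedModule.
Variables (G : groupoid) (D : graded_ring G) (M : graded_module D).
Implicit Types (g h k : G) (m n s : M) (a b c : D) (S T N : set M).

Local Notation rproj := (component (rcomp_sum D)).
Local Notation mproj := (component (mcomp_sum M)).

Lemma gmulI g h k : dom g = cod h -> dom g = cod k ->
  gmul g h = gmul g k -> h = k.
Proof.
move=> gh gk /(congr1 (gmul (ginv g))).
rewrite !gmulA ?dom_inv// gmulVg [in X in gmul X h]gh [in X in _ = gmul X k]gk.
by rewrite !gmul_idl.
Qed.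

Lemma gmulKV g h : cod h = cod g -> gmul g (gmul (ginv g) h) = h.
Proof.
by move=> e; rewrite gmulA ?cod_inv ?dom_inv// gmulgV -e gmul_idl.
Qed.

Lemma mact0l a : mact (0 : M) a = 0.
Proof. by apply: (addIr (mact (0 : M) a)); rewrite add0r -mactDl addr0. Qed.

Lemma mact0r m : mact m 0 = 0.
Proof. by apply: (addIr (mact m 0)); rewrite add0r -mactDr addr0. Qed.

Lemma mactNl m a : mact (- m) a = - mact m a.
Proof. by apply: (addIr (mact m a)); rewrite -mactDl !addNr mact0l. Qed.

Lemma mactNr m a : mact m (- a) = - mact m a.
Proof. by apply: (addIr (mact m a)); rewrite -mactDr !addNr mact0r. Qed.

Lemma rmul0r a : rmul a 0 = 0.
Proof. by apply: (addIr (rmul a 0)); rewrite add0r -rmulDr addr0. Qed.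

Lemma rmulNr a b : rmul a (- b) = - rmul a b.
Proof. by apply: (addIr (rmul a b)); rewrite -rmulDr !addNr rmul0r. Qed.

(** Left translation by g is injective on the morphisms that can be composed
with g, so only the component of a in degree k can contribute to the degree
gk. *)
Lemma component_mact g k s a : mcomp g s -> dom g = cod k ->
  mproj (gmul g k) (mact s a) = mact s (rproj k a).
Proof.
move=> sg gk.
apply: (component_ind (rcomp_sum D)
    (fun c => mproj (gmul g k) (mact s c) = mact s (rproj k c)) a).
- by rewrite mact0r !component0 mact0r.
- by move=> u w Hu Hw; rewrite mactDr !componentD Hu Hw mactDr.
move=> h; have ch := component_in (rcomp_sum D) h a.
have [gh|gh] := pselect (dom g = cod h); last first.
  rewrite (mcomp_act0 sg ch)// component0 (component_hom _ k ch).
  by case: eqP => [kh|_]; [rewrite -kh gk in gh|rewrite mact0r].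
rewrite (component_hom _ _ (mcomp_act sg ch gh)) (component_hom _ k ch).
case: (eqVneq k h) => [->|kh]; first by rewrite eqxx.
rewrite ifN ?mact0r//; apply: contra_neq kh; exact: gmulI.
Qed.

Lemma component_mact0 g h s a : mcomp g s -> cod h <> cod g ->
  mproj h (mact s a) = 0.
Proof.
move=> sg hg.
apply: (component_ind (rcomp_sum D) (fun c => mproj h (mact s c) = 0) a).
- by rewrite mact0r component0.
- by move=> u w Hu Hw; rewrite mactDr componentD Hu Hw addr0.
move=> k; have ck := component_in (rcomp_sum D) k a.
have [gk|gk] := pselect (dom g = cod k); last first.
  by rewrite (mcomp_act0 sg ck)// component0.
rewrite (component_hom _ _ (mcomp_act sg ck gk)).
by case: eqP => // hE; rewrite hE cod_mul in hg.
Qed.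

(** Unitality MR = M enters here only.  In a product of homogeneous elements u
and a, the right factor already satisfies a 1 = a for the identity at the
domain of its degree, so the claim holds for each component of a sum of
products. *)
Lemma mact_robj1 g s : mcomp g s -> mact s (robj1 D (dom g)) = s.
Proof.
move=> sg; rewrite -(component_id (mcomp_sum M) sg).
have [n [u [a ->]]] := mact_unital s.
pose P m := mact (mproj g m) (robj1 D (dom g)) = mproj g m.
have P0 : P 0 by rewrite /P component0 mact0l.
have PD u' w : P u' -> P w -> P (u' + w).
  by rewrite /P componentD mactDl => -> ->.
rewrite -/(P _); apply: big_ind => // j _.
move: (u j) (a j) => {}u {}a.
apply: (component_ind (mcomp_sum M) (fun m => P (mact m a)) u).
- by rewrite mact0l.
- by move=> u' w Hu Hw; rewrite mactDl; exact: PD.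
move=> h; apply: (component_ind (rcomp_sum D)
    (fun a => P (mact (mproj h u) a)) a).
- by rewrite mact0r.
- by move=> u' w Hu Hw; rewrite mactDr; exact: PD.
move=> k; have uh := component_in (mcomp_sum M) h u.
have ak := component_in (rcomp_sum D) k a.
have [hk|hk] := pselect (dom h = cod k); last by rewrite (mcomp_act0 uh ak).
rewrite /P (component_hom _ g (mcomp_act uh ak hk)).
case: eqP => [->|_]; last by rewrite mact0l.
by rewrite dom_mul// mactA (robj1_mulr ak).
Qed.

(** * Submodules and spans *)

Definition span S : set M :=
  [set m | forall N, submodule N -> S `<=` N -> N m].

Lemma submodule_span S : submodule (span S).
Proof.
split=> [|m a Sm N subN SN]; last by apply: subN.2; exact: Sm.
apply/zmod_closed_setP; split=> [|u v Su Sv] N subN SN;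
  have /zmod_closed_setP[N0 NB] := subN.1 => //.
by apply: NB; [exact: Su|exact: Sv].
Qed.

Lemma submodule0 N : submodule N -> N 0.
Proof. by case=> /zmod_closed_setP[]. Qed.

Lemma submoduleB N m n : submodule N -> N m -> N n -> N (m - n).
Proof. by case=> /zmod_closed_setP[_ NB] _; exact: NB. Qed.

Lemma submoduleN N m : submodule N -> N m -> N (- m).
Proof.
by move=> sN Nm; rewrite -sub0r; apply: submoduleB => //; exact: submodule0.
Qed.

Lemma submoduleD N m n : submodule N -> N m -> N n -> N (m + n).
Proof.
by move=> sN Nm Nn; rewrite -(opprK n); apply: submoduleB => //;
  exact: submoduleN.
Qed.

Lemma span_sub S : S `<=` span S.
Proof. by move=> m Sm N _; exact. Qed.

Lemma span_min S N : submodule N -> S `<=` N -> span S `<=` N.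
Proof. by move=> sN SN m; exact. Qed.

Lemma spanS S T : S `<=` T -> span S `<=` span T.
Proof.
move=> ST; exact: (span_min (submodule_span T) (subset_trans ST (@span_sub T))).
Qed.

Definition graded_set S := forall m, S m -> exists g, mcomp g m.

(** A submodule generated by homogeneous elements is graded.  The induction runs
over the generation of m; the property must speak of all products m a as well
in order to be preserved by the action of D. *)
Lemma span_graded S g m : graded_set S -> span S m -> span S (mproj g m).
Proof.
move=> gS; have sS := submodule_span S; have S0 := submodule0 sS.
pose Q m := forall g, span S (mproj g m) /\ forall a, span S (mproj g (mact m a)).
suff QS : span S `<=` Q by move=> /QS /(_ g) [].
apply: span_min.
  split.
    apply/zmod_closed_setP; split=> [h|u v Qu Qv h].
      by split=> [|a]; rewrite ?mact0l component0.
    split=> [|a]; first by rewrite componentB; apply: (submoduleB sS);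
      [exact: (Qu h).1|exact: (Qv h).1].
    rewrite mactDl mactNl componentB; apply: (submoduleB sS).
      exact: (Qu h).2.
    exact: (Qv h).2.
  by move=> u a Qu h; split=> [|b]; rewrite ?mactA; exact: (Qu h).2.
move=> s Ss h; have [k sk] := gS s Ss; have Hs := span_sub Ss; split=> [|a].
  by rewrite (component_hom _ h sk); case: eqP.
have [hk|hk] := pselect (cod h = cod k); last first.
  by rewrite (component_mact0 a sk hk).
rewrite -(gmulKV hk) (component_mact _ sk) ?cod_mul ?cod_inv ?dom_inv//.
exact: sS.2.
Qed.

Lemma span_setU1 S g (h m : M) : mcomp g h -> span (S `|` [set h]) m ->
  exists a, span S (m - mact h a).
Proof.
move=> hg; pose N : set M := [set m | exists a, span S (m - mact h a)].
suff : span (S `|` [set h]) `<=` N by apply.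
apply: span_min => [|s [Ss|->]].
- have sS := submodule_span S; split.
    apply/zmod_closed_setP; split=> [|u v [a Sa] [b Sb]].
      by exists 0; rewrite mact0r subr0; exact: submodule0.
    exists (a - b); have := submoduleB sS Sa Sb.
    by rewrite mactDr mactNr !opprD !opprK addrACA.
  move=> u b [a Sa]; exists (rmul a b); rewrite -mactA -mactNl -mactDl.
  exact: sS.2.
- by exists 0; rewrite mact0r subr0; exact: span_sub.
- exists (robj1 D (dom g)); rewrite (mact_robj1 hg) subrr.
  exact: submodule0 (submodule_span S).
Qed.

(** * Independent sets of homogeneous elements *)

Definition indep S := graded_set S /\ forall s, S s -> ~ span (S `\ s) s.

(** Finite character, in the form needed for Zorn's lemma: along a chain of sets
the union of the spans is a submodule, so a dependence in the union of the
chain already occurs in one of its members. *)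
Lemma indep_bigcup (F : set (set M)) :
  F `<=` indep -> total_on F subset -> indep (\bigcup_(X in F) X).
Proof.
move=> Find Ftot; split=> [s [X FX Xs]|s [X FX Xs]].
  exact: (Find X FX).1 s Xs.
pose N : set M := \bigcup_(X in F) span (X `\ s).
have dir m n : N m -> N n ->
    exists2 Y, F Y & span (Y `\ s) m /\ span (Y `\ s) n.
  move=> [Y FY Ym] [Z FZ Zn].
  have [YZ|ZY] := Ftot Y Z FY FZ; [exists Z => //|exists Y => //]; split=> //.
    by move: Ym; apply: spanS; exact: setSD.
  by move: Zn; apply: spanS; exact: setSD.
have : span (\bigcup_(X in F) X `\ s) `<=` N.
  apply: span_min.
    split.
      apply/zmod_closed_setP; split=> [|m n Nm Nn].
        by exists X => //; exact: submodule0 (submodule_span _).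
      have [Y FY [Ym Yn]] := dir m n Nm Nn.
      by exists Y => //; exact: submoduleB (submodule_span _) Ym Yn.
    by move=> m a [Y FY Ym]; exists Y => //; exact: (submodule_span _).2.
  move=> m [[Y FY Ym] ms]; exists Y => //; exact: span_sub.
move=> /[apply] -[Y FY Ys].
have [XY|YX] := Ftot X Y FX FY; first exact: ((Find Y FY).2 s (XY _ Xs)).
by apply: ((Find X FX).2 s Xs); move: Ys; apply: spanS; exact: setSD.
Qed.

Lemma indepS S T : S `<=` T -> indep T -> indep S.
Proof.
move=> ST [gT indT]; split=> [s /ST/gT//|s Ss Hs].
by apply: (indT s (ST s Ss)); apply: spanS Hs; exact: setSD.
Qed.

Hypothesis hD : graded_division_ring D.

Lemma submodule_div N g k s a : submodule N -> mcomp g s -> rcomp k a ->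
  dom g = cod k -> a <> 0 -> N (mact s a) -> N s.
Proof.
move=> sN sg ak gk a0 /sN.2; have [b [_ ab _]] := hD.2 _ _ ak a0.
by move=> /(_ b); rewrite mactA ab -gk (mact_robj1 sg).
Qed.

(** The exchange property.  If s in S were spanned by the other elements of S
and h, then s - h a would be in the span of S \ s for some a.  In the degree of
s this reads s - h b with b homogeneous; b = 0 contradicts the independence of
S, and otherwise b is invertible, so that h is in the span of S. *)
Lemma indep_setU1 S g (h : M) : indep S -> mcomp g h -> ~ span S h ->
  indep (S `|` [set h]).
Proof.
move=> [gS indS] hg hS; split=> [s [/gS//|->]|s Hs]; first by exists g.
have [->|/eqP sh] := pselect (s = h).
  by move=> hU; apply: hS; apply: spanS hU => m [[]].
case: Hs => [Ss|//]; last by move=> sh'; rewrite sh' eqxx in sh.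
move=> Us; pose N := span (S `\ s).
have sN : submodule N := submodule_span _.
have gN : graded_set (S `\ s) by move=> m [/gS].
have [a Na] : exists a, N (s - mact h a).
  by apply: (span_setU1 hg); apply: spanS Us => m [[]]; [left|right].
have [k sk] := gS s Ss.
have := span_graded k gN Na; rewrite componentB (component_id _ sk).
have [kg|kg] := pselect (cod k = cod g); last first.
  by rewrite (component_mact0 a hg kg) subr0; exact: indS.
have gk : dom g = cod (gmul (ginv g) k) by rewrite cod_mul ?cod_inv ?dom_inv.
rewrite -[in mproj _ _](gmulKV kg) (component_mact _ hg gk).
set b := rproj _ _ => Nb.
have [b0|b0] := pselect (b = 0).
  by move: Nb; rewrite b0 mact0r subr0; exact: indS.
apply: hS; apply: (submodule_div (submodule_span S) hg _ gk b0).
  exact: component_in.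
have /(submoduleB (submodule_span S) (span_sub Ss)) : span S (s - mact h b).
  by apply: spanS Nb => m [].
by rewrite opprB addrC subrK.
Qed.

(** A homogeneous s outside the span of homogeneous elements is torsion free
modulo this span, up to the part of c that s annihilates: the components of
s c are products of s with components of c, and a nonzero component of c could
be inverted. *)
Lemma graded_cancel S g s c : graded_set S -> mcomp g s -> ~ span S s ->
  span S (mact s c) -> rmul (robj1 D (dom g)) c = 0.
Proof.
move=> gS sg Ss Sc.
apply: (component_ind (rcomp_sum D)
    (fun c => rmul (robj1 D (dom g)) c = 0) c).
- exact: rmul0r.
- by move=> u w Hu Hw; rewrite rmulDr Hu Hw addr0.
move=> k; have ck := component_in (rcomp_sum D) k c.
have [gk|gk] := pselect (dom g = cod k); last first.
  by apply: (rcomp_mul0 (robj1_comp D (dom g)) ck); rewrite dom_id.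
rewrite gk (robj1_mull ck); apply: contrapT => c0; apply: Ss.
apply: (submodule_div (submodule_span S) sg ck gk c0).
by rewrite -(component_mact _ sg gk); exact: span_graded.
Qed.

(** * Pseudo-independent families and independent sets *)

Lemma fsum_mact_support (I : choiceType) (x : I -> M) (a : I -> D) :
  finite_set [set i | a i != 0] -> finite_set [set i | mact (x i) (a i) != 0].
Proof.
apply: sub_finite_set => i /=; apply: contra_neq => ->; exact: mact0r.
Qed.

(** This submodule contains the span of the other x_j, and its members are
written with coefficients in the ideals to which pseudo-linear independence
refers. *)
Definition combinations_avoiding (I : choiceType) (g : I -> G) (x : I -> M)
    (i : I) : set M :=
  [set m | exists a : I -> D,
    [/\ in_direct_sum (fun j => obj_ideal (dom (g j))) a, a i = 0
      & m = \sum_(j \in [set: I]) mact (x j) (a j)]].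

Lemma submodule_combinations_avoiding (I : choiceType) (g : I -> G)
  (x : I -> M) (i : I) : submodule (combinations_avoiding g x i).
Proof.
split.
  apply/zmod_closed_setP; split=> [|m n].
    exists (fun=> 0); split=> //.
      split=> [j|]; first by exists 0; rewrite ?rmul0r.
      apply: (@sub_finite_set _ _ set0) => // j /=.
      by rewrite eqxx.
    by rewrite fsbig1// => j _; rewrite mact0r.
  move=> [a [[Aa fa] ai ->]] [b [[Ab fb] bi ->]].
  exists (fun j => a j - b j); split; last 2 first.
  - by rewrite ai bi subr0.
  - rewrite -fsumrB; try exact: fsum_mact_support.
    by apply: eq_fsbigr => j _; rewrite mactDr mactNr.
  split; last exact: finite_supportB.
  move=> j; have [c _ <-] := Aa j; have [d _ <-] := Ab j.
  by exists (c - d) => //; rewrite rmulDr rmulNr.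
move=> m b [a [[Aa fa] ai ->]]; exists (fun j => rmul (a j) b).
have r0 : rmul 0 b = 0 :> D.
  by apply: (addIr (rmul 0 b)); rewrite add0r -rmulDl addr0.
split; last 2 first.
- by rewrite ai.
- rewrite (fsumr_morph (phi := fun m => mact m b)).
  + by apply: eq_fsbigr => j _; rewrite mactA.
  + exact: mact0l.
  + by move=> u v; rewrite mactDl.
  + exact: fsum_mact_support.
split=> [j|]; first by have [c _ <-] := Aa j; exists (rmul c b); rewrite ?rmulA.
by apply: sub_finite_set fa => j /=; apply: contra_neq => ->.
Qed.

(** A coincidence x_i = x_j is a dependence too, which is why injectivity is
part of the conclusion: the range alone would forget repetitions. *)
Lemma pseudo_independent_indep (I : choiceType) (x : I -> M) :
  pseudo_independent x -> injective x /\ indep (range x).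
Proof.
move=> [g [hx xind]].
have xg i := (hx i).1.
pose A i := @obj_ideal G D (dom (g i)).
have A0 i : A i 0 by exists 0; rewrite ?rmul0r.
have AN1 i : A i (- robj1 D (dom (g i))).
  exists (- robj1 D (dom (g i))) => //=; rewrite rmulNr; congr (- _).
  by have := robj1_mulr (robj1_comp D (dom (g i))); rewrite dom_id.
pose N := combinations_avoiding g x.
have Nx i j : j != i -> N i (x j).
  move=> ji; exists (fun l => - (if l == j then - robj1 D (dom (g j)) else 0)).
  split; last 2 first.
  - by rewrite eq_sym (negPf ji) oppr0.
  - rewrite -[LHS](fsumr1 j); apply: eq_fsbigr => l _.
    case: eqP => [->|_]; last by rewrite oppr0 mact0r.
    by rewrite opprK (mact_robj1 (xg j)).
  split=> [l|]; last first.
    apply: sub_finite_set (finite_support1 j (- robj1 D (dom (g j)))) => l /=.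
    by rewrite oppr_eq0.
  case: eqP => [->|_]; last by rewrite oppr0; exact: A0.
  rewrite opprK; have [c _ cE] := AN1 j.
  by exists (- c) => //; rewrite rmulNr cE opprK.
have xN i : ~ N i (x i).
  (* Otherwise sum_j x_j a_j - x_i = 0 is a dependence in which x_i has
     coefficient -1, so that 1 = 0 at the domain of g_i and x_i = x_i 1 = 0. *)
  move=> [a [[Aa fa] ai xE]].
  pose e := robj1 D (dom (g i)).
  pose b j := a j - (if j == i then e else 0).
  have bA : in_direct_sum A b.
    split; last exact: finite_supportB fa (finite_support1 _ _).
    move=> j; rewrite /b; case: eqP => [->|_]; last first.
      by rewrite subr0; exact: Aa.
    by rewrite ai sub0r; exact: AN1.
  have bE j : mact (x j) (b j) =
      mact (x j) (a j) - (if j == i then x i else 0).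
    rewrite /b mactDr mactNr; congr (_ - _).
    by case: eqP => [->|_]; [exact: mact_robj1|exact: mact0r].
  have /(_ _ i) : \sum_(j \in [set: I]) mact (x j) (b j) = 0 ->
      forall j, b j = 0 by exact: xind.
  rewrite /b eqxx ai sub0r => /(_ _)/eqP; rewrite oppr_eq0 => b0.
  apply: (hx i).2; rewrite -(mact_robj1 (xg i)) -/e.
  rewrite (eqP (b0 _)) ?mact0r//.
  under eq_fsbigr do rewrite bE.
  rewrite fsumrB ?fsumr1 -?xE ?subrr//; first exact: fsum_mact_support.
  exact: finite_support1.
have xinj : injective x.
  move=> i j xik; apply/eqP; apply: contrapT => /negP ik.
  by apply: (xN j); rewrite -xik; exact: Nx.
split=> //; split=> [_ [i _ <-]|_ [i _ <-]]; first by exists (g i).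
move=> Si; apply: (xN i).
apply: (span_min (submodule_combinations_avoiding g x i)) Si.
move=> _ [[j _ <-]] /eqP xji.
by apply: Nx; apply: contra_neq xji => ->.
Qed.

(** If sum_j x_j a_j = 0 then x_i a_i is in the span of the other x_j, and x_i is
cancellable modulo this span. *)
Lemma indep_pseudo_independent (I : choiceType) (x : I -> M) :
  injective x -> indep (range x) -> pseudo_independent x.
Proof.
move=> xinj [gS ind].
have hg i : exists g, mcomp g (x i) by apply: gS; exists i.
exists (fun i => sval (cid (hg i))).
have xg i : mcomp (sval (cid (hg i))) (x i) by exact: svalP (cid (hg i)).
split=> [i|a [Aa fa] Sa i].
  split=> // x0; apply: (ind (x i)); first by exists i.
  by rewrite [X in span _ X]x0; exact: submodule0 (submodule_span _).
have [c _ cE] := Aa i.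
rewrite -cE; apply: (@graded_cancel (range x `\ x i) _ (x i)) => //.
- by move=> m [/gS].
- by apply: ind; exists i.
have -> : mact (x i) c = mact (x i) (a i) by rewrite -cE -mactA mact_robj1.
have sN := submodule_span (range x `\ x i).
have fxa := fsum_mact_support x fa.
pose f j := mact (x j) (a j) - (if j == i then mact (x i) (a i) else 0).
have -> : mact (x i) (a i) = - \sum_(j \in [set: I]) f j.
  by rewrite fsumrB ?fsumr1 ?Sa ?sub0r ?opprK//; exact: finite_support1.
apply: (submoduleN sN).
have [B fB] := finite_support_fset (finite_supportB fxa
  (finite_support1 i (mact (x i) (a i)))).
rewrite (@fsbigTE _ _ _ _ B)//.
apply: (big_ind (span (range x `\ x i))).
- exact: submodule0 sN.
- by move=> u v; exact: submoduleD sN.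
move=> j _; rewrite /f; case: (eqVneq j i) => [->|ji].
  by rewrite subrr; exact: submodule0 sN.
rewrite subr0; apply: sN.2; apply: span_sub; split; first by exists j.
by move=> /xinj/eqP; rewrite (negPf ji).
Qed.

Lemma generatesP (I : Type) (x : I -> M) :
  generates x <-> span (range x) = setT.
Proof.
split=> [gx|sx N sN Nx].
  by apply: gx => [|i]; [exact: submodule_span|apply: span_sub; exists i].
rewrite -subTset -sx; apply: span_min => // _ [i _ <-]; exact: Nx.
Qed.

(** * Maximal independent sets and cardinality *)

(** The added elements T are taken disjoint from S so that S and T together can
be listed without repetition. *)
Lemma exists_maximal_indep S : indep S ->
  exists T, [/\ indep (S `|` T), T `&` S = set0 & span (S `|` T) = setT].
Proof.
move=> indS; pose P T := indep (S `|` T).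
have [F FP Ftot|T [PT Tmax]] := @Zorn_bigcup M P.
  have [->|/set0P[X0 FX0]] := eqVneq F set0.
    by rewrite /P bigcup_set0 setU0.
  rewrite /P -bigcupUr; last by exists X0.
  rewrite -(bigcup_image F (setU S) id); apply: indep_bigcup => [_ [X FX <-]|].
    exact: FP.
  move=> _ _ [X FX <-] [Y FY <-].
  by have [XY|YX] := Ftot X Y FX FY; [left|right]; exact: setUS.
exists (T `\` S); rewrite setUDr setDv setD0; split=> //.
  by rewrite setDE -setIA setICl setI0.
(* Every homogeneous element is spanned: otherwise it could be adjoined. *)
rewrite -subTset => m _; apply: (component_ind (mcomp_sum M) (span (S `|` T)) m).
- exact: submodule0 (submodule_span _).
- by move=> u w; exact: submoduleD (submodule_span _).
move=> g; set h := mproj g m.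
have hg : mcomp g h by exact: component_in.
apply: contrapT => hS; apply: (Tmax (T `|` [set h])).
  split; first exact: subsetUl.
  move=> /(_ h (or_intror erefl)) Th; apply: hS; apply: span_sub; by right.
by rewrite /P setUA; exact: indep_setU1 hg hS.
Qed.

(** Zorn's lemma is applied to the graphs R of partial injections of A into B
such that the set X R, obtained from A by replacing each element of the domain of
R by its image, is independent.  In addition the image of R may meet A only
inside the domain, so that the elements of A left in place are different from
the new ones. *)
Lemma indep_card_le A B : indep A -> graded_set B -> span B = setT ->
  (A #<= B)%card.
Proof.
move=> indA gB spB.
pose X (R : set (M * M)) := (A `\` (fst @` R)) `|` (snd @` R).
pose P (R : set (M * M)) := [/\ R `<=` A `*` B,
  forall z w, R z -> R w -> z.1 = w.1 -> z = w,
  forall z w, R z -> R w -> z.2 = w.2 -> z = w,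
  A `&` (snd @` R) `<=` fst @` R & indep (X R)].
have [F FP Ftot|R [[RAB R1 R2 RAdom RX] Rmax]] := @Zorn_bigcup _ P.
  set U := \bigcup_(R in F) R.
  have common z w : U z -> U w -> exists2 R, F R & R z /\ R w.
    move=> [Q FQ Qz] [R FR Rw]; have [QR|RQ] := Ftot Q R FQ FR.
      by exists R => //; split=> //; exact: QR.
    by exists Q => //; split=> //; exact: RQ.
  split.
  - by move=> z [R FR Rz]; have [RAB _ _ _ _] := FP R FR; exact: RAB.
  - move=> z w Uz Uw; have [R FR [Rz Rw]] := common z w Uz Uw.
    by have [_ R1 _ _ _] := FP R FR; exact: R1.
  - move=> z w Uz Uw; have [R FR [Rz Rw]] := common z w Uz Uw.
    by have [_ _ R2 _ _] := FP R FR; exact: R2.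
  - move=> m [Am [z [R FR Rz] zm]]; have [_ _ _ RAdom _] := FP R FR.
    have [|w Rw wm] := RAdom m; first by split=> //; exists z.
    by exists w => //; exists R.
  have [F0|/set0P[R0 FR0]] := eqVneq F set0.
    by rewrite /X /U F0 bigcup_set0 !image_set0 setD0 setU0.
  (* The sets X R do not increase with R, as the domain grows and leaves A.  The
     sets Y R do, lie in X R, and have union X U. *)
  pose Y (R : set (M * M)) := (A `\` (fst @` U)) `|` (snd @` R).
  have -> : X U = \bigcup_(Z in Y @` F) Z.
    apply/seteqP; split=> [m [Am|[z [R FR Rz] zm]]|].
    - by exists (Y R0); [exists R0|left].
    - by exists (Y R); [exists R|right; exists z].
    - move=> m [_ [R FR <-]] [Am|[z Rz <-]]; first by left.
      by right; exists z => //; exists R.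
  apply: indep_bigcup => [_ [R FR <-]|_ _ [Q FQ <-] [R FR <-]].
    have [_ _ _ _] := FP R FR; apply: indepS; apply: setSU => m [Am Um].
    by split=> // -[z Rz zm]; apply: Um; exists z => //; exists R.
  by have [QR|RQ] := Ftot Q R FQ FR; [left|right];
    apply: setUS; exact: image_subset.
have AR : A `<=` fst @` R.
  move=> a Aa; apply: contrapT => Ra.
  have aR : ~ (snd @` R) a by move=> Ra2; exact/Ra/RAdom.
  pose Y := X R `\ a.
  have Ya : ~ span Y a by apply: RX.2; left.
  (* As B spans M and Y does not span a, some b in B is not spanned by Y. *)
  have [b Bb Yb] : exists2 b, B b & ~ span Y b.
    apply: contrapT => /forall2NP nB; apply: Ya.
    have : span B `<=` span Y.
      apply: span_min; first exact: submodule_span.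
      by move=> b Bb; have [//|/contrapT] := nB b.
    by rewrite spB; exact.
  have YR m : (snd @` R) m -> Y m.
    by move=> Rm; split=> [|ma]; [right|rewrite ma in Rm].
  have bR : ~ (snd @` R) b by move=> /YR /span_sub.
  apply: (Rmax (R `|` [set (a, b)])).
    split; first exact: subsetUl.
    by move=> /(_ (a, b) (or_intror erefl)) Rab; apply: Ra; exists (a, b).
  split.
  - by move=> z [/RAB//|->].
  - move=> z w [Rz|->] [Rw|->] //=; first exact: R1.
      by move=> za; case: Ra; exists z.
    by move=> wa; case: Ra; exists w.
  - move=> z w [Rz|->] [Rw|->] //=; first exact: R2.
      by move=> zb; case: bR; exists z.
    by move=> wb; case: bR; exists w.
  - move=> m [Am [z Rz zm]].
    have [[w Rw wm]|Rm] := pselect ((fst @` R) m).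
      by exists w => //; left.
    case: Rz => [Rz|zE].
      by case: Rm; apply: RAdom; split=> //; exists z.
    exists (a, b); first by right.
    apply: contrapT => /= am; apply: Yb; apply: span_sub.
    have -> : b = m by rewrite -zm zE.
    by split; [left|exact: nesym].
  have [g bg] := gB b Bb.
  apply: indepS (indep_setU1 (indepS _ RX) bg Yb); last by move=> m [].
  move=> m [[Am Rm]|[z [Rz|->] <-]]; last by right.
    left; split; last by move=> ma; apply: Rm; exists (a, b) => //; right.
    by left; split=> // -[z Rz zm]; apply: Rm; exists z => //; left.
  by left; apply: YR; exists z.
have c1 : (fst @` R #= R)%card.
  by apply: inj_card_eq => z w; rewrite !inE; exact: R1.
have c2 : (snd @` R #= R)%card.
  by apply: inj_card_eq => z w; rewrite !inE; exact: R2.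
apply: card_le_trans (subset_card_le AR) _.
rewrite (card_le_eql c1) -(card_le_eql c2); apply: subset_card_le.
by move=> _ [z /RAB[_ Bz] <-].
Qed.

End GradedModule.

Theorem theorem4p4 (G : groupoid) (D : graded_ring G)
    (hD : graded_division_ring D) (M : graded_module D) :
  [/\ pseudo_free M,
      (forall (I : choiceType) (x : I -> M), pseudo_independent x ->
         exists (J : choiceType) (y : J -> M),
           pseudo_basis (fun k : (I + J)%type =>
                           match k with inl i => x i | inr j => y j end))
    & (forall (I J : choiceType) (x : I -> M) (y : J -> M),
         pseudo_basis x -> pseudo_basis y -> ([set: I] #= [set: J])%card)].
Proof.
have extend (I : choiceType) (x : I -> M) : pseudo_independent x ->
    exists (J : choiceType) (y : J -> M),
      pseudo_basis (fun k : (I + J)%type =>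
                      match k with inl i => x i | inr j => y j end).
  move=> /pseudo_independent_indep[xinj xind].
  have [T [indT dT spT]] := exists_maximal_indep hD xind.
  exists T, set_val.
  set z := (z in pseudo_basis z).
  have zE : range z = range x `|` T.
    apply/seteqP; split=> [_ [[i|j] _ <-]|m [[i _ <-]|Tm]].
    - by left; exists i.
    - by right; exact: set_valP.
    - by exists (inl i).
    - by exists (inr (SigSub (mem_set Tm))).
  have xT i (j : T) : x i <> set_val j.
    move=> xij; suff : (T `&` range x) (x i) by rewrite dT.
    by split; [rewrite xij; exact: set_valP|exists i].
  split; last by apply/generatesP; rewrite zE.
  apply: indep_pseudo_independent => //; last by rewrite zE.
  move=> [i|j] [k|l] //= e.
  - by rewrite (xinj _ _ e).
  - by case: (xT _ _ e).
  - by case: (xT _ _ (esym e)).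
  - by rewrite (val_inj e).
split=> //.
  have [] := extend void (of_void M).
    by apply: (indep_pseudo_independent hD) => [[]|]; split=> [_ [[]]|_ [[]]].
  by move=> J [y yb]; do 2 eexists; exact: yb.
have card_le (I J : choiceType) (x : I -> M) (y : J -> M) :
    pseudo_basis x -> pseudo_basis y -> ([set: I] #<= [set: J])%card.
  move=> [/pseudo_independent_indep[xinj xind] _].
  move=> [/pseudo_independent_indep[yinj [gy _]] /generatesP sy].
  have xI := inj_card_eq (in2W xinj : {in [set: I] &, injective x}).
  have yJ := inj_card_eq (in2W yinj : {in [set: J] &, injective y}).
  rewrite -(card_le_eql xI) -(card_le_eqr yJ).
  exact: (indep_card_le hD xind gy sy).
move=> I J x y bx b_y; rewrite card_eq_le.
by apply/andP; split; [exact: card_le bx b_y|exact: card_le b_y bx].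
Qed.
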